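(* Let $N\in\mathbb{N}$ and let $L_\Phi$ be the Lipschitz constant of $\Phi$ restricted to the interval $(0,2)$. Let $v_i^0$, $i=1,\ldots,N$, denote initially distinct positions in $(0,1)$, and let the weight matrix $\tilde W=(\tilde w_{i,j})\in(\mathbb{R}_0^+)^{N\times N}$, with $\tilde w_{i,i}>0$ for all $i$, have constant columns, i.e. $\tilde w_{j,\ell}=\tilde w_{i,\ell}$ for $1\le i,j,\ell\le N$. Let $v^k$ denote the iterates of the explicit scheme $$v_i^{k+1}=v_i^k+\tau\sum_{\ell\in J_2^i}\tilde w_{i,\ell}\,\Phi(v_\ell^k-v_i^k)-\tau\sum_{\ell=1}^N\tilde w_{i,\ell}\,\Phi(v_\ell^k+v_i^k),\qquad i=1,\ldots,N,$$ let $0<v_i^k<v_j^k<1$, and assume that the time step size $\tau$ satisfies $$0<\tau<\frac{1}{2\,L_\Phi\,\max_{1\le i\le N}\sum_{\ell=1}^N\tilde w_{i,\ell}}.$$ Then $v_i^{k+1}<v_j^{k+1}$.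
   Context: $J_2^i:=\{\ell\in\{1,\ldots,N\}\mid v_\ell^k\neq v_i^k\}$. The upper index $k$ is the time level (time $k\tau$). Penaliser and flux: $\Psi:\mathbb{R}_0^+\to\mathbb{R}$ is such that $s\mapsto\Psi(s^2)$ is continuously differentiable, decreasing and strictly convex on $[0,1]$, with $\Psi(0)=0$ and vanishing left-sided derivative at $s=1$. It is extended to $[-1,1]$ by symmetry (evenness) and to $\mathbb{R}$ by periodicity $\Psi((2+s)^2)=\Psi(s^2)$. The flux is $\Phi(s):=\Psi'(s^2)\,s$, i.e. half the derivative of $s\mapsto\Psi(s^2)$, defined for $s$ not an even integer. Hence $\Phi(-s)=-\Phi(s)$, $\Phi(2+s)=\Phi(s)$, $\Phi$ is continuous and increasing on $(0,2)$, $\Phi(1)=0$, and $\Phi$ has jump discontinuities at the even integers. $\Phi$ is assumed Lipschitz on $(0,2)$. *)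

(* Defs.v *)
From HB Require Import structures.
From mathcomp Require Import all_boot all_order all_algebra.
From mathcomp Require Import all_classical all_reals all_analysis.

Set Implicit Arguments.
Unset Strict Implicit.
Unset Printing Implicit Defensive.

Import Order.TTheory GRing.Theory Num.Theory.
Import numFieldNormedType.Exports.

Local Open Scope classical_set_scope.
Local Open Scope ring_scope.

(* The difference quotients only see points of [a, b], so the derivative is
   one-sided at the endpoints. *)
Definition continuously_differentiable_on (R : realType) (a b : R)
    (f : R -> R) : Prop :=
  exists df : R -> R,
    (forall s, s \in `[a, b] ->
      (f t - f s) / (t - s) @[t --> within `[a, b] s^'] --> df s) /\
    {within `[a, b], continuous df}.

Definition strictly_decreasing_on (R : realType) (a b : R) (f : R -> R) : Prop :=
  forall x y, x \in `[a, b] -> y \in `[a, b] -> x < y -> f y < f x.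

Definition strictly_convex_on (R : realType) (a b : R) (f : R -> R) : Prop :=
  forall x y t, x \in `[a, b] -> y \in `[a, b] -> x != y -> 0 < t < 1 ->
    f (t * x + (1 - t) * y) < t * f x + (1 - t) * f y.

(* Psi is the penaliser after extension: a function on the nonnegative reals
   whose values on negative reals are irrelevant, as it is only ever evaluated
   at squares. The extension of s |-> Psi (s ^+ 2) by evenness needs no field:
   it holds by construction. *)
Record penaliser (R : realType) (Psi : R -> R) : Prop := Penaliser {
  penaliser_C1 : continuously_differentiable_on 0 1 (fun s => Psi (s ^+ 2));
  penaliser_decreasing : strictly_decreasing_on 0 1 (fun s => Psi (s ^+ 2));
  penaliser_convex : strictly_convex_on 0 1 (fun s => Psi (s ^+ 2));
  penaliser0 : Psi 0 = 0;
  penaliser_left_derivative1 :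
    (Psi (t ^+ 2) - Psi (1 ^+ 2)) / (t - 1) @[t --> 1^'-] --> (0 : R);
  penaliser_periodic : forall s : R, Psi ((2 + s) ^+ 2) = Psi (s ^+ 2) }.

(* Meaningful when s is not an even integer; at even integers, where the flux
   is undefined, this total function takes an unspecified value. *)
Definition flux (R : realType) (Psi : R -> R) (s : R) : R :=
  derive1 Psi (s ^+ 2) * s.

Definition is_lipschitz_constant (R : realType) (A : set R) (f : R -> R)
    (L : R) : Prop :=
  L.-lipschitz_A f /\ forall L' : R, L'.-lipschitz_A f -> L <= L'.

Definition J2 (R : realType) (N : nat) (v : 'I_N -> R) (i : 'I_N) : {set 'I_N} :=
  [set l | v l != v i]%SET.

Definition explicit_step (R : realType) (N : nat) (Phi : R -> R) (W : 'M[R]_N)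
    (tau : R) (v : 'I_N -> R) : 'I_N -> R :=
  fun i => v i + tau * \sum_(l in J2 v i) W i l * Phi (v l - v i)
               - tau * \sum_l W i l * Phi (v l + v i).

Definition explicit_scheme (R : realType) (N : nat) (Phi : R -> R) (W : 'M[R]_N)
    (tau : R) (v0 : 'I_N -> R) (k : nat) : 'I_N -> R :=
  iter k (explicit_step Phi W tau) v0.

(* The default value 0 of the maximum is harmless: it is only used for
   nonnegative matrices. *)
Definition max_row_sum (R : realType) (N : nat) (W : 'M[R]_N) : R :=
  \big[Num.max/0]_i \sum_l W i l.

(* Main.v *)
(* As the columns of W are constant, all particles move by the same map
     F x = x + tau * sum_l w_l * (Phi (v_l - x) - Phi (v_l + x)).
   When x increases from a to b, the sum changes by at least
   - 2 L (b - a) * sum_l w_l: both flux terms are L-Lipschitz away from x = v_l,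
   where the sum jumps upwards. The bound on tau thus makes F strictly increasing on [0, 1], which
   preserves the order. By the symmetries of Phi, F fixes 0 and 1, so the
   positions of all particles stay in (0, 1), where these estimates apply. *)
Require Import Defs.
From HB Require Import structures.
From mathcomp Require Import all_boot all_order all_algebra.
From mathcomp Require Import all_classical all_reals all_analysis.
From mathcomp Require Import ring lra.

Import Order.TTheory GRing.Theory Num.Theory.
Import numFieldNormedType.Exports.

Local Open Scope classical_set_scope.
Local Open Scope ring_scope.

(** For [t] close to an interior point [s], the restriction to [[a, b]] is vacuous. This turns the
    limits in [continuously_differentiable_on] into ordinary derivability. *)
Lemma derivable_within_itv (R : realType) (f : R -> R) (a b s l : R) :
  a < s < b ->
  (f t - f s) / (t - s) @[t --> within `[a, b] s^'] --> l ->
  derivable f s 1.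
Proof.
move=> /andP[as_ sb] fl; apply/cvg_ex; exists l.
have shift_cvg : h + s @[h --> (0 : R)^'] --> within `[a, b] s^'.
  have sab : \forall t \near s, t \in `]a, b[.
    by apply: near_in_itvoo; rewrite in_itv /= as_.
  move=> P Ps.
  have {}Ps : \forall t \near s, t != s -> t \in `[a, b] -> P t by exact: Ps.
  have {Ps} : \forall t \near s, t != s -> P t.
    near=> t => ts; apply: (near Ps t) => //.
    by apply: (@subset_itv_oo_cc _ _ a b t); near: t.
  rewrite (near_shift 0 s) subr0 => Ps.
  suff : \forall h \near (0 : R), h != 0 -> P (h + s) by [].
  by apply: filterS Ps => h /= Ph h0; apply: Ph; rewrite -subr_eq0 addrK.
apply: cvg_trans (cvg_comp _ _ shift_cvg fl).
apply: near_eq_cvg; near=> h.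
by rewrite /= addrK [h *: 1]mulr1 [RHS]mulrC.
Unshelve. all: by end_near.
Qed.

(** Smoothness is assumed for [s |-> Psi (s ^+ 2)], whereas [flux] differentiates [Psi] itself. Near
    [r ^+ 2 > 0], [Psi] is recovered by composing with the square root, which is differentiable
    there. *)
Lemma derivable_of_sqr (R : realType) (Psi : R -> R) (r : R) :
  0 < r -> derivable (fun s : R => Psi (s ^+ 2)) r 1 -> derivable Psi (r ^+ 2) 1.
Proof.
move=> r0 dPsi.
have r2 : 0 < r ^+ 2 by rewrite exprn_gt0.
apply: (@near_eq_derivable _ _ _ ((fun s : R => Psi (s ^+ 2)) \o Num.sqrt)).
  near=> x; rewrite /= sqr_sqrtr//.
  by apply: ltW; near: x; exact: lt_nbhsr.
apply: diff_derivable; apply: differentiable_comp; apply/derivable1_diffP.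
  by have [] := is_derive1_sqrt r2.
by rewrite sqrtr_sqr gtr0_norm.
Unshelve. all: by end_near.
Qed.

Lemma fluxE (R : realType) (Psi : R -> R) (r : R) :
  0 < r -> derivable (fun s : R => Psi (s ^+ 2)) r 1 ->
  flux Psi r = derive1 (fun s : R => Psi (s ^+ 2)) r / 2.
Proof.
move=> r0 dPsi; rewrite /flux.
have -> : derive1 (fun s : R => Psi (s ^+ 2)) r = derive1 Psi (r ^+ 2) * (2 * r).
  rewrite (@derive1_comp _ (fun s : R => s ^+ 2) Psi)//.
  - by rewrite [X in _ * X]derive1E exp_derive expr1 scaler1 -mulr_natl.
  - exact: derivable_of_sqr.
by field.
Qed.

Lemma fluxN (R : realType) (Psi : R -> R) (s : R) : flux Psi (- s) = - flux Psi s.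
Proof. by rewrite /flux sqrrN mulrN. Qed.

Lemma flux0 (R : realType) (Psi : R -> R) : flux Psi 0 = 0.
Proof. by rewrite /flux mulr0. Qed.

Lemma penaliser_derivable (R : realType) (Psi : R -> R) (s : R) :
  penaliser Psi -> 0 < s < 1 -> derivable (fun t : R => Psi (t ^+ 2)) s 1.
Proof.
move=> /penaliser_C1[df [hdf _]] /[dup] s01 /andP[s0 s1].
apply: (derivable_within_itv _ _ _ _ _ _ _ (hdf s _)) => //.
by rewrite in_itv /= !ltW.
Qed.

Lemma flux_le0 (R : realType) (Psi : R -> R) (s : R) :
  penaliser Psi -> 0 < s < 1 -> flux Psi s <= 0.
Proof.
move=> hPsi /[dup] s01 /andP[s0 _].
rewrite fluxE//; last exact: penaliser_derivable.
rewrite ler_pdivrMr// mul0r.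
apply: (@decr_derive1_le0_itv _ _ true false 0 1).
- by move=> x; rewrite inE /= in_itv /= => x01; exact: penaliser_derivable.
- by move=> x y x01 y01; apply: penaliser_decreasing.
- by rewrite in_itv.
Qed.

(** Evenness and period 2 make [s |-> Psi (s ^+ 2)] symmetric about 1, so its derivative is
    antisymmetric about 1. *)
Lemma flux_reflect (R : realType) (Psi : R -> R) (r : R) :
  penaliser Psi -> 0 < r < 1 -> flux Psi (2 - r) = - flux Psi r.
Proof.
move=> hPsi /[dup] r01 /andP[r0 r1].
pose h s := Psi (s ^+ 2).
have hE : h = h \o (fun s => 2 - s).
  by apply/funext => s; rewrite /h /= (penaliser_periodic hPsi) sqrrN.
have dr : derivable h r 1 by exact: penaliser_derivable.
have d2 (x : R) : is_derive x 1 (fun s : R => 2 - s) (-1).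
  by rewrite -[-1]sub0r; apply: is_deriveB.
(* Writing [r] as the reflection of [2 - r] lets derivability pass to [2 - r] through [hE]. *)
have dhr : derivable h (2 - (2 - r)) 1 by rewrite opprB addrCA subrr addr0.
have dh2r : derivable h (2 - r) 1.
  rewrite hE; apply: diff_derivable; apply: differentiable_comp; apply/derivable1_diffP => //.
rewrite !fluxE//; last by lra.
rewrite -mulNr; congr (_ / _).
rewrite -/h {1}hE derive1_comp//.
rewrite [X in _ * X]derive1E (@derive_val _ _ _ _ _ _ _ (d2 _)) mulrN1.
by rewrite opprB addrCA subrr addr0.
Qed.

Lemma lipschitz_itv_le (R : realType) (f : R -> R) (L a b x y : R) :
  L.-lipschitz_(`]a, b[) f -> a < x -> x < y -> y < b ->
  `|f y - f x| <= L * (y - x).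
Proof.
move=> hL ax xy yb.
have := hL (y, x); rewrite /= !in_itv/= => /(_ _).
rewrite (gtr0_norm (x := y - x)) ?subr_gt0//; apply; split; lra.
Qed.

(* For [u] in [a, b] the Lipschitz bound does not apply across the jump of the
   flux at 0; there the sign of the flux gives [flux Psi (u - a) <= 0] and
   [0 <= flux Psi (u - b)]. *)
Lemma flux_force_ge (R : realType) (Psi : R -> R) (L u a b : R) :
  penaliser Psi -> L.-lipschitz_(`]0, 2[) (flux Psi) ->
  0 < u < 1 -> 0 <= a -> a < b -> b <= 1 ->
  - (2 * L * (b - a)) <=
  (flux Psi (u - b) - flux Psi (u + b)) - (flux Psi (u - a) - flux Psi (u + a)).
Proof.
move=> hPsi hL /andP[u0 u1] a0 ab b1.
have lip := @lipschitz_itv_le _ _ _ _ _ _ _ hL.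
have Hplus : flux Psi (u + b) - flux Psi (u + a) <= L * (b - a).
  have -> : b - a = (u + b) - (u + a) by lra.
  by apply: le_trans (ler_norm _) (lip _ _ _ _ _); lra.
suff : - (L * (b - a)) <= flux Psi (u - b) - flux Psi (u - a) by lra.
have Lge0 : 0 <= L * (b - a).
  have -> : b - a = (u + b) - (u + a) by lra.
  by apply: le_trans (normr_ge0 _) (lip _ _ _ _ _); lra.
have neg x : 0 < x < 1 -> flux Psi x <= 0 by exact: flux_le0.
(* For [u] outside [a, b], [u - a] and [u - b] lie on the same side of the jump at 0, so the
   Lipschitz bound applies, after using oddness when [u < a]. *)
have [bu|ub] := ltP b u.
  have -> : b - a = (u - a) - (u - b) by lra.
  rewrite lerNl opprB.
  by apply: le_trans (ler_norm _) (lip _ _ _ _ _); lra.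
have [ua|au] := ltP u a.
  have -> : b - a = (b - u) - (a - u) by lra.
  rewrite -(opprB b u) -(opprB a u) !fluxN opprK lerNl opprD opprK.
  by apply: le_trans (ler_norm _) (lip _ _ _ _ _); lra.
have P1 : 0 <= flux Psi (u - b).
  move: ub; rewrite le_eqVlt => /orP[/eqP->|ub]; first by rewrite subrr flux0.
  by rewrite -(opprB b u) fluxN oppr_ge0; apply: neg; lra.
have P2 : flux Psi (u - a) <= 0.
  move: au; rewrite le_eqVlt => /orP[/eqP->|au]; first by rewrite subrr flux0.
  by apply: neg; lra.
by lra.
Qed.

(* Position after one time step of a massless test particle starting at [x]. *)
Definition step_map {R : realType} {N : nat} (Psi : R -> R) (w v : 'I_N -> R)
    (tau x : R) : R :=
  x + tau * \sum_l w l * (flux Psi (v l - x) - flux Psi (v l + x)).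

(* The formal value [flux Psi 0 = 0] makes the restriction to [J2] redundant. *)
Lemma explicit_stepE (R : realType) (N : nat) (Psi : R -> R) (W : 'M[R]_N)
    (tau : R) (v : 'I_N -> R) (i : 'I_N) :
  explicit_step (flux Psi) W tau v i = step_map Psi (W i) v tau (v i).
Proof.
rewrite /explicit_step /step_map -addrA -mulrBr; congr (_ + _ * _).
under [RHS]eq_bigr do rewrite mulrBr.
rewrite sumrB; congr (_ - _).
rewrite [RHS](bigID (mem (J2 v i)))/= [X in _ + X]big1 ?addr0// => l.
by rewrite inE negbK => /eqP->; rewrite subrr flux0 mulr0.
Qed.

Lemma step_map_lt (R : realType) (N : nat) (Psi : R -> R) (L tau : R)
    (w v : 'I_N -> R) (a b : R) :
  penaliser Psi -> L.-lipschitz_(`]0, 2[) (flux Psi) ->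
  (forall l, 0 <= w l) -> (forall l, 0 < v l < 1) ->
  0 < tau -> tau * (2 * L * \sum_l w l) < 1 ->
  0 <= a -> a < b -> b <= 1 ->
  step_map Psi w v tau a < step_map Psi w v tau b.
Proof.
move=> hPsi hL w0 v01 tau0 tauL a0 ab b1; rewrite /step_map.
pose g x l := flux Psi (v l - x) - flux Psi (v l + x).
have : - (2 * L * (b - a)) * \sum_l w l <=
    \sum_l w l * g b l - \sum_l w l * g a l.
  rewrite -sumrB mulr_sumr; apply: ler_sum => l _.
  by rewrite -mulrBr mulrC ler_wpM2l// flux_force_ge.
rewrite -(ler_pM2l tau0) mulrBr.
(* [H1] is the positivity of [(b - a) * (1 - tau * (2 * L * \sum_l w l))], which by [H2] bounds the
   increment of the map from below. *)
have := tauL; rewrite -subr_gt0 -(pmulr_rgt0 _ (_ : 0 < b - a)) ?subr_gt0// => H1 H2.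
rewrite -subr_gt0.
apply: lt_le_trans H1 _.
rewrite -/(g a) -/(g b).
lra.
Qed.

Lemma step_map0 (R : realType) (N : nat) (Psi : R -> R) (w v : 'I_N -> R)
    (tau : R) : step_map Psi w v tau 0 = 0.
Proof.
rewrite /step_map big1 ?mulr0 ?addr0// => l _.
by rewrite subr0 addr0 subrr mulr0.
Qed.

(** Each summand vanishes: [flux Psi (v l + 1) = - flux Psi (1 - v l) = flux Psi (v l - 1)], by
    reflection about 1 and oddness. *)
Lemma step_map1 (R : realType) (N : nat) (Psi : R -> R) (w v : 'I_N -> R)
    (tau : R) :
  penaliser Psi -> (forall l, 0 < v l < 1) -> step_map Psi w v tau 1 = 1.
Proof.
move=> hPsi v01; rewrite /step_map big1 ?mulr0 ?addr0// => l _.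
have /andP[v0 v1] := v01 l.
have -> : v l + 1 = 2 - (1 - v l) by lra.
by rewrite flux_reflect ?opprK -?(opprB 1 (v l)) ?fluxN ?addNr ?mulr0//; lra.
Qed.

Theorem theorem10 (R : realType) (Psi : R -> R) (hPsi : penaliser Psi)
  (L : R) (hL : is_lipschitz_constant `]0, 2[ (flux Psi) L)
  (N : nat) (v0 : 'I_N -> R)
  (hv0_distinct : injective v0)
  (hv0_range : forall i : 'I_N, 0 < v0 i < 1)
  (W : 'M[R]_N)
  (hW_nonneg : forall i l : 'I_N, 0 <= W i l)
  (hW_diag : forall i : 'I_N, 0 < W i i)
  (hW_columns : forall i j l : 'I_N, W j l = W i l)
  (tau : R) (htau_pos : 0 < tau)
  (htau : tau < 1 / (2 * L * max_row_sum W))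
  (k : nat) (i j : 'I_N)
  (hvi_pos : 0 < explicit_scheme (flux Psi) W tau v0 k i)
  (hvij : explicit_scheme (flux Psi) W tau v0 k i <
          explicit_scheme (flux Psi) W tau v0 k j)
  (hvj_lt1 : explicit_scheme (flux Psi) W tau v0 k j < 1) :
  explicit_scheme (flux Psi) W tau v0 k.+1 i <
  explicit_scheme (flux Psi) W tau v0 k.+1 j.
Proof.
set M := max_row_sum W in htau.
have [lipL _] := hL.
have M0 : 0 <= M by exact: bigmax_ge_id.
(* Otherwise the upper bound on [tau] would be nonpositive; this includes the case of a zero
   denominator, whose inverse is 0 by convention. *)
have LM0 : 0 < 2 * L * M.
  rewrite ltNge; apply/negP => LM.
  have := lt_trans htau_pos htau.
  by rewrite div1r invr_gt0 ltNge LM.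
have L0 : 0 <= L.
  rewrite leNgt; apply/negP => Lneg; move: LM0.
  by rewrite ltNge mulr_le0_ge0// pmulr_rle0// ltW.
have tauL p : tau * (2 * L * \sum_l W p l) < 1.
  move: htau; rewrite ltr_pdivlMr//; apply: le_lt_trans.
  rewrite ler_pM2l// ler_wpM2l ?mulr_ge0//.
  exact: (le_bigmax 0 (fun p => \sum_l W p l) p).
(* The monotonicity estimate needs all particles in (0, 1), not only [i] and [j]. In the induction,
   each new position is compared with the images of the fixed points 0 and 1. *)
have v01 m p : 0 < explicit_scheme (flux Psi) W tau v0 m p < 1.
  elim: m p => [|m IH] p; first exact: hv0_range.
  rewrite /explicit_scheme iterS -/(explicit_scheme _ _ _ _ m) explicit_stepE.
  set v := explicit_scheme _ _ _ _ m in IH *.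
  have /andP[vp0 vp1] := IH p.
  apply/andP; split.
    rewrite -(@step_map0 _ _ Psi (W p) v tau).
    by apply: (@step_map_lt _ _ _ L) => //; exact: ltW.
  rewrite -[ltRHS](@step_map1 _ _ Psi (W p) v tau hPsi IH).
  by apply: (@step_map_lt _ _ _ L) => //; exact: ltW.
rewrite /explicit_scheme !iterS -/(explicit_scheme _ _ _ _ k) !explicit_stepE.
have -> : W j = W i :> ('I_N -> R) by apply/funext => l; exact: hW_columns.
by apply: (@step_map_lt _ _ _ L) => //; exact: ltW.
Qed.
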